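(* Let $d=2$ and $f\in L^2(0,t^\ast;H^{-1}(\Omega)^2)$ with $f^{n+1}=f(t^{n+1})\in H^{-1}(\Omega)^2$ for $0\le n\le N-1$. Let $u_h^0\in X_h$ and let $(\hat u_h^{n+1},p_h^{n+1},u_h^{n+1})$, $n=0,\dots,N-1$, be generated by Algorithm 2 (described in the context) with parameters $\nu>0$, $\gamma\ge 0$, $\Delta t>0$. Then $$\|u^{N}_{h}\|^{2} + \gamma \Delta t \Big(\|u^{N}_{1h,1}\|^{2} + \|u^{N}_{2h,2}\|^{2}\Big) + \sum_{n=0}^{N-1}\Big(\|\hat{u}^{n+1}_{h} - u^{n+1}_{h}\|^{2} + \|\hat{u}^{n+1}_{h} - u^{n}_{h}\|^{2}\Big)$$ $$+ \gamma \Delta t \sum_{n=0}^{N-1}\Big(\|u^{n+1}_{1h,1} + u^{n}_{2h,2} \|^{2} + \|u^{n+1}_{2h,2} + u^{n}_{1h,1} \|^{2}\Big) + \nu\Delta t\sum_{n=0}^{N-1}\|\nabla\hat u_h^{n+1}\|^2$$ $$\le \|u^{0}_{h}\|^{2}+ \gamma \Delta t \Big(\|u^{0}_{1h,1}\|^{2} + \|u^{0}_{2h,2}\|^{2}\Big) + \frac{\Delta t}{\nu}\sum_{n=0}^{N-1}\|f^{n+1}\|_{-1}^2 .$$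
   Context: $\Omega\subset\mathbb R^2$ is a convex polygonal domain; $(\cdot,\cdot)$ and $\|\cdot\|$ are the $L^2(\Omega)$ inner product and norm (also used for the $H^{-1}$–$H^1_0$ duality pairing); $\|\cdot\|_{-1}$ is the norm of $H^{-1}(\Omega)^2$ dual to $v\mapsto\|\nabla v\|$ on $H_0^1(\Omega)^2$. $X=H^1_0(\Omega)^2$, $Q=L^2_0(\Omega)$ (mean-zero $L^2$ functions). The trilinear form is $b(u,v,w)=\tfrac12(u\cdot\nabla v,w)-\tfrac12(u\cdot\nabla w,v)$. $X_h\subset X$ and $Q_h\subset Q$ are conforming finite element spaces (continuous piecewise polynomials on a quasi-uniform mesh of size $h$) satisfying the discrete inf-sup condition $\inf_{q_h\in Q_h}\sup_{v_h\in X_h}\frac{(q_h,\nabla\cdot v_h)}{\|q_h\|\|\nabla v_h\|}\ge\alpha>0$ with $\alpha$ independent of $h$. Time levels are $t^n=n\Delta t$, $n=0,\dots,N$, $t^\ast=N\Delta t$. For a vector field $v=(v_1,v_2)$, $v_{i,j}=\partial v_i/\partial x_j$; for the discrete velocity $u_h^n=(u_{1h}^n,u_{2h}^n)$, $u^n_{ih,j}=\partial u^n_{ih}/\partial x_j$. Lagged grad-div form: for a sequence $(u^n)$ in $X$ and $v\in X$, $$gd_{lag}(u^{n},v)=(u^{n}_{1,1},v_{1,1}) + (u^{n-1}_{2,2},v_{1,1}) + (u^{n-1}_{1,1},v_{2,2}) + (u^{n}_{2,2},v_{2,2}).$$ Algorithm 2. Step 1: given $u_h^n\in X_h$, find $(\hat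 u_h^{n+1},p_h^{n+1})\in X_h\times Q_h$ such that $$\Big(\tfrac{\hat u_h^{n+1}-u_h^n}{\Delta t},v_h\Big)+b(u_h^n,\hat u_h^{n+1},v_h)+\nu(\nabla\hat u_h^{n+1},\nabla v_h)-(p_h^{n+1},\nabla\cdot v_h)=(f^{n+1},v_h)\quad\forall v_h\in X_h,$$ $$(\nabla\cdot\hat u_h^{n+1},q_h)=0\quad\forall q_h\in Q_h.$$ Step 2: given $\hat u_h^{n+1}$ (and $u_h^n$), find $u_h^{n+1}\in X_h$ such that $$(u_h^{n+1},v_h)+\gamma\Delta t\, gd_{lag}(u_h^{n+1},v_h)=(\hat u_h^{n+1},v_h)\quad\forall v_h\in X_h.$$ *)

(* Defs.v *)
From HB Require Import structures.
From mathcomp Require Export all_boot all_order all_algebra.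
From mathcomp Require Export all_classical all_reals all_analysis.

Set Implicit Arguments.
Unset Strict Implicit.
Unset Printing Implicit Defensive.

Import Order.TTheory GRing.Theory Num.Theory.
Import numFieldNormedType.Exports.

Local Open Scope classical_set_scope.
Local Open Scope ring_scope.

(** * Plane geometry *)
Section Geometry.
Variable R : realType.
Local Notation P := (R * R)%type.
Implicit Types (s : seq P) (Omega : set P) (T : seq (3.-tuple P)).

Definition conv_hull s : set P :=
  [set x | exists w : 'I_(size s) -> R,
     [/\ forall i, 0 <= w i, \sum_i w i = 1 & x = \sum_i w i *: s`_i]].

Definition convex_polygonal Omega :=
  Omega !=set0 /\ exists s, Omega = (conv_hull s)°.

(** The library norm on [R * R] is the sup norm; mesh sizes are Euclidean. *)
Definition edist (x y : P) : R :=
  Num.sqrt ((x.1 - y.1) ^+ 2 + (x.2 - y.2) ^+ 2).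

(** A mesh is the list of its triangles, a triangle being given by its three
    vertices.  Two triangles may only meet in the hull of their common vertices,
    i.e. in the empty set, a vertex, an edge, or everything. *)
Definition triangulation Omega T :=
  [/\ closure Omega = [set x | exists2 K, K \in T & conv_hull K x],
      forall K, K \in T -> (conv_hull K)° !=set0 &
      forall K L, K \in T -> L \in T ->
        conv_hull K `&` conv_hull L = conv_hull [seq x <- K | x \in val L]].

(** [h] is the largest diameter of a triangle. *)
Definition mesh_size T (h : R) :=
  (forall K, K \in T ->
     forall x y, conv_hull K x -> conv_hull K y -> edist x y <= h) /\
  (exists K x y,
     [/\ K \in T, conv_hull K x, conv_hull K y & edist x y = h]).

(** [Th h] is the mesh of size [h]; the constant [rho] does not depend on [h]. *)
Definition quasi_uniform (H : set R) (Th : R -> seq (3.-tuple P)) (rho : R) :=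
  0 < rho /\ forall h, H h -> forall K, K \in Th h ->
    exists c, [set x | edist c x <= rho * h] `<=` conv_hull K.

Definition poly_le (k : nat) (g : P -> R) :=
  exists c : nat -> nat -> R, forall x : P,
    g x = \sum_(i < k.+1) \sum_(j < k.+1 | (i + j <= k)%N)
            c i j * x.1 ^+ i * x.2 ^+ j.

Definition cont_pw_poly Omega T (k : nat) (g : P -> R) :=
  {within closure Omega, continuous g} /\
  forall K, K \in T ->
    exists2 q, poly_le k q & forall x, conv_hull K x -> g x = q x.

End Geometry.

(** * Lebesgue and Sobolev spaces
    Elements of L^2(Omega) are represented by functions on the whole plane, whose
    values off Omega play no role. *)
Section Spaces.
Variable R : realType.
Local Notation P := (R * R)%type.
Local Notation F := (P -> R).
Local Notation VF := (F * F)%type.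
Variable Omega : set P.
Implicit Types (f g phi : F) (u v w : VF) (L : VF -> R).

Definition leb2 := (@lebesgue_measure R \x @lebesgue_measure R)%E.

Definition L2 f : Prop := (f \_ Omega) \in Lfun leb2 2%:E.

Definition L2ip f g : R := \int[leb2]_(x in Omega) (f x * g x).
Definition L2norm f : R := Num.sqrt (L2ip f f).
Definition L2vip u v : R := L2ip u.1 v.1 + L2ip u.2 v.2.
Definition L2vnorm u : R := Num.sqrt (L2vip u u).

Definition L20 f : Prop := L2 f /\ \int[leb2]_(x in Omega) f x = 0.

Definition iter_derive (es : seq P) phi : F :=
  foldr (fun e g => (fun x => 'D_e g x)) phi es.

(** C_c^oo(Omega) *)
Definition test_function phi :=
  (forall es x, differentiable (iter_derive es phi) x) /\
  (exists K, [/\ compact K, K `<=` Omega & forall x, ~ K x -> phi x = 0]).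

Definition is_weak_derive (e : P) f g :=
  L2 g /\ forall phi, test_function phi ->
    L2ip f (fun x => 'D_e phi x) = - L2ip g phi.

(** Total operator: a representative of the weak derivative of [f] in the
    direction [e] if it exists in L^2(Omega), the zero function otherwise. *)
Definition weak_derive (e : P) f : F := xget 0 [set g | is_weak_derive e f g].

Definition d1 f : F := weak_derive (1, 0) f.
Definition d2 f : F := weak_derive (0, 1) f.

Definition H1 f :=
  [/\ L2 f, exists g, is_weak_derive (1, 0) f g
          & exists g, is_weak_derive (0, 1) f g].

(** The closure of C_c^oo(Omega) in H^1(Omega). *)
Definition H10 f :=
  H1 f /\ forall eps : R, 0 < eps -> exists2 phi, test_function phi &
    L2norm (f - phi) ^+ 2 + L2norm (d1 f - (fun x => 'D_(1, 0) phi x)) ^+ 2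
      + L2norm (d2 f - (fun x => 'D_(0, 1) phi x)) ^+ 2 < eps ^+ 2.

Definition X v := H10 v.1 /\ H10 v.2.

Definition divergence v : F := d1 v.1 + d2 v.2.

Definition grad_ip u v : R :=
  L2ip (d1 u.1) (d1 v.1) + L2ip (d2 u.1) (d2 v.1)
  + L2ip (d1 u.2) (d1 v.2) + L2ip (d2 u.2) (d2 v.2).
Definition grad_norm v : R := Num.sqrt (grad_ip v v).

(** H^{-1}(Omega)^2: the bounded linear functionals on X, whose values off X play
    no role; [L v] is the duality pairing. *)
Definition Hm1 L :=
  (forall (a : R) u v, X u -> X v -> L (a *: u + v) = a * L u + L v) /\
  (exists C, forall v, X v -> `|L v| <= C * grad_norm v).

Definition Hm1norm L : R :=
  sup [set r | exists v, [/\ X v, grad_norm v != 0 & r = `|L v| / grad_norm v]].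

(** ** L^2(0, T; H^{-1}(Omega)^2), in the sense of Bochner *)

Definition simple_Hm1 (s : R -> VF -> R) :=
  exists m (A : 'I_m -> set R) (G : 'I_m -> VF -> R),
    [/\ forall i, measurable (A i), forall i, Hm1 (G i) &
        forall t v, s t v = \sum_(i < m) \1_(A i) t * G i v].

Definition L2_Hm1 (T : R) (f : R -> VF -> R) :=
  [/\ {ae @lebesgue_measure R, forall t, t \in `]0, T[ -> Hm1 (f t)},
      exists s : nat -> R -> VF -> R,
        (forall k, simple_Hm1 (s k)) /\
        {ae @lebesgue_measure R, forall t, t \in `]0, T[ ->
          Hm1norm (f t - s k t) @[k --> \oo] --> (0 : R)} &
      (\int[@lebesgue_measure R]_(t in `]0%R, T[) (Hm1norm (f t) ^+ 2)%:E
         < +oo)%E].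

(** ** Forms *)

Definition advect u v : VF :=
  (u.1 \* d1 v.1 \+ u.2 \* d2 v.1, u.1 \* d1 v.2 \+ u.2 \* d2 v.2).

Definition trilinear_form u v w : R :=
  2^-1 * L2vip (advect u v) w - 2^-1 * L2vip (advect u w) v.

(** Only used at positive indices [n]. *)
Definition gd_lag (u : nat -> VF) (n : nat) v : R :=
  L2ip (d1 (u n).1) (d1 v.1) + L2ip (d2 (u n.-1).2) (d1 v.1)
  + L2ip (d1 (u n.-1).1) (d2 v.2) + L2ip (d2 (u n).2) (d2 v.2).

End Spaces.

(** * Discretisation *)
Section Scheme.
Variable R : realType.
Local Notation P := (R * R)%type.
Local Notation F := (P -> R).
Local Notation VF := (F * F)%type.
Variable Omega : set P.
Implicit Types (Xh : set VF) (Qh : set F).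

Definition subspace (V : lmodType R) (S : set V) :=
  S 0 /\ forall (a : R) x y, S x -> S y -> S (a *: x + y).

Definition fe_velocity_space (T : seq (3.-tuple P)) (k : nat) Xh :=
  [/\ subspace Xh, Xh `<=` X Omega & forall v, Xh v ->
        cont_pw_poly Omega T k v.1 /\ cont_pw_poly Omega T k v.2].

Definition fe_pressure_space (T : seq (3.-tuple P)) (k : nat) Qh :=
  [/\ subspace Qh, Qh `<=` L20 Omega & forall q, Qh q ->
        cont_pw_poly Omega T k q].

Definition inf_sup (alpha : R) Xh Qh :=
  (alpha%:E <= ereal_inf
     [set ereal_sup
       [set (L2ip Omega q (divergence Omega v)
               / (L2norm Omega q * grad_norm Omega v))%:E
         | v in [set v | Xh v /\ grad_norm Omega v != 0%R]]
     | q in [set q | Qh q /\ L2norm Omega q != 0%R]])%E.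

(** [uhat], [p], [u] are the sequences of the algorithm, indexed by time level;
    [f] is the load functional at level [n.+1]. *)
Definition step1 Xh Qh (nu dt : R) (f : VF -> R)
    (u uhat : nat -> VF) (p : nat -> F) (n : nat) :=
  [/\ Xh (uhat n.+1), Qh (p n.+1),
      forall v, Xh v ->
        L2vip Omega (dt^-1 *: (uhat n.+1 - u n)) v
        + trilinear_form Omega (u n) (uhat n.+1) v
        + nu * grad_ip Omega (uhat n.+1) v
        - L2ip Omega (p n.+1) (divergence Omega v) = f v &
      forall q, Qh q -> L2ip Omega (divergence Omega (uhat n.+1)) q = 0].

Definition step2 Xh (gamma dt : R) (u uhat : nat -> VF) (n : nat) :=
  Xh (u n.+1) /\
  forall v, Xh v ->
    L2vip Omega (u n.+1) v + gamma * dt * gd_lag Omega u n.+1 v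
    = L2vip Omega (uhat n.+1) v.

End Scheme.

(* Main.v *)
Require Import Defs.
From mathcomp Require Import all_boot all_order all_algebra.
From mathcomp Require Import all_classical all_reals all_analysis.
From mathcomp Require Import ring lra.

Import Order.TTheory GRing.Theory Num.Theory.
Import numFieldNormedType.Exports.

Local Open Scope classical_set_scope.
Local Open Scope ring_scope.

(** The bound is the sum over the time levels of a one-step energy balance that
    comes from testing each equation of the scheme with its own unknown.

    Testing the momentum equation with the intermediate velocity makes the
    skew-symmetric convection term and, by the discrete incompressibility, the
    pressure term vanish.  The identity 2 (a - b, a) = |a|^2 - |b|^2 + |a - b|^2
    turns the time difference into kinetic energies, and the load is absorbed by
    half of the viscous term (the dual norm estimate [Hm1norm_ge], then Young's
    inequality).

    Testing the grad-div step with the new velocity gives the same energy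
    identity together with the lagged form at that velocity.  Twice this form is
    a sum of two squares plus the increment, between two time levels, of
    |u_1,1|^2 + |u_2,2|^2 ([gd_lag_energy]); this is why lagging the coupling
    terms keeps the scheme unconditionally stable.

    In the sum of the two balances the energy of the intermediate velocity
    cancels ([energy_step]), and the energies of consecutive levels telescope.

    All functions involved are in L^2, so that the pairings may be expanded: the
    velocities because the discrete space is contained in H^1_0, and the weak
    derivatives by construction. *)

(** * The L^2 pairing *)

Lemma L2_0 (R : realType) (Omega : set (R * R)) : L2 Omega (0 : R * R -> R).
Proof.
rewrite /L2.
have -> : (0 : R * R -> R) \_ Omega = 0 by apply/funext => x; rewrite patchE if_same.
have le12 : (1 <= 2%:E :> \bar R)%E by rewrite lee_fin ler1n.
by have [] := @Lfun_submod_closed _ _ _ (@leb2 R) _ le12.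
Qed.

Lemma L2_comb (R : realType) (Omega : set (R * R)) (a : R) (f g : R * R -> R) :
  L2 Omega f -> L2 Omega g -> L2 Omega (a *: f + g).
Proof.
rewrite /L2 => Lf Lg.
have -> : (a *: f + g) \_ Omega = a *: (f \_ Omega) + g \_ Omega.
  apply/funext => x; rewrite !fctE !patchE; case: ifP => // _.
  (* Restrictions take the value [point] off the set, which is 0 in [R]. *)
  by rewrite -[point]/(0 : R) scaler0 addr0.
have le12 : (1 <= 2%:E :> \bar R)%E by rewrite lee_fin ler1n.
by have [_] := @Lfun_submod_closed _ _ _ (@leb2 R) _ le12; apply.
Qed.

Lemma L2ipC (R : realType) (Omega : set (R * R)) (f g : R * R -> R) :
  L2ip Omega f g = L2ip Omega g f.
Proof. by apply: eq_Rintegral => x _; rewrite mulrC. Qed.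

(** Integrals over [Omega] are integrals over the plane of functions extended by
    zero; the membership [L2] and the product estimate for L^2 functions are
    about these extensions. *)
Lemma L2ip_patch (R : realType) (Omega : set (R * R)) (f g : R * R -> R) :
  L2ip Omega f g = \int[@leb2 R]_x ((f \_ Omega) x * (g \_ Omega) x).
Proof.
rewrite /L2ip Rintegral_mkcond; apply: eq_Rintegral => x _.
by rewrite !patchE; case: ifP => // _; rewrite -[point]/(0 : R) mulr0.
Qed.

Lemma L2ip_comb (R : realType) (Omega : set (R * R)) (a : R)
    (f g k : R * R -> R) :
  L2 Omega f -> L2 Omega g -> L2 Omega k ->
  L2ip Omega (a *: f + g) k = a * L2ip Omega f k + L2ip Omega g k.
Proof.
rewrite /L2 => Lf Lg Lk; rewrite !L2ip_patch.
have /Lfun1_integrable ifk := Lfun2_mul_Lfun1 Lf Lk.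
have /Lfun1_integrable igk := Lfun2_mul_Lfun1 Lg Lk.
rewrite -RintegralZl// -RintegralD//; last first.
  by have := integrableZl measurableT a ifk; apply: eq_integrable.
apply: eq_Rintegral => x _; rewrite !fctE !patchE; case: ifP => _.
  by rewrite mulrDl mulrA.
by rewrite -[point]/(0 : R) !mulr0 addr0.
Qed.

Lemma L2ip_ge0 (R : realType) (Omega : set (R * R)) (f : R * R -> R) :
  0 <= L2ip Omega f f.
Proof. by apply: Rintegral_ge0 => x _; rewrite -expr2 sqr_ge0. Qed.

Lemma L2norm_sqr (R : realType) (Omega : set (R * R)) (f : R * R -> R) :
  L2norm Omega f ^+ 2 = L2ip Omega f f.
Proof. by rewrite sqr_sqrtr// L2ip_ge0. Qed.

Lemma L2norm_comb (R : realType) (Omega : set (R * R)) (a : R)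
    (f g : R * R -> R) :
  L2 Omega f -> L2 Omega g ->
  L2norm Omega (a *: f + g) ^+ 2 =
  a ^+ 2 * L2norm Omega f ^+ 2 + 2 * a * L2ip Omega f g + L2norm Omega g ^+ 2.
Proof.
move=> Lf Lg; have Lfg := L2_comb _ _ a _ _ Lf Lg.
rewrite !L2norm_sqr L2ip_comb// !(L2ipC _ _ _ (a *: f + g)) !L2ip_comb//.
by rewrite (L2ipC _ _ g f); ring.
Qed.

Lemma L2normD (R : realType) (Omega : set (R * R)) (f g : R * R -> R) :
  L2 Omega f -> L2 Omega g ->
  L2norm Omega (f + g) ^+ 2 =
  L2norm Omega f ^+ 2 + 2 * L2ip Omega f g + L2norm Omega g ^+ 2.
Proof.
by move=> Lf Lg; rewrite -[f in LHS]scale1r L2norm_comb// expr1n mulr1 mul1r.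
Qed.

Lemma L2vnorm_sqr (R : realType) (Omega : set (R * R))
    (v : (R * R -> R) * (R * R -> R)) :
  L2vnorm Omega v ^+ 2 = L2norm Omega v.1 ^+ 2 + L2norm Omega v.2 ^+ 2.
Proof. by rewrite !L2norm_sqr sqr_sqrtr// addr_ge0// L2ip_ge0. Qed.

Lemma grad_norm_sqr (R : realType) (Omega : set (R * R))
    (v : (R * R -> R) * (R * R -> R)) :
  grad_norm Omega v ^+ 2 = grad_ip Omega v v.
Proof. by rewrite sqr_sqrtr// !addr_ge0// L2ip_ge0. Qed.

Definition vL2 {R : realType} (Omega : set (R * R))
    (v : (R * R -> R) * (R * R -> R)) : Prop :=
  L2 Omega v.1 /\ L2 Omega v.2.

Lemma X_vL2 (R : realType) (Omega : set (R * R))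
    (v : (R * R -> R) * (R * R -> R)) :
  X Omega v -> vL2 Omega v.
Proof. by case=> -[[]] L1 _ _ _ [[]]. Qed.

Lemma vfun_subE (R : realType) (v w : (R * R -> R) * (R * R -> R)) :
  v - w = ((-1) *: w.1 + v.1, (-1) *: w.2 + v.2).
Proof. by rewrite !scaleN1r ![- _ + _]addrC. Qed.

Lemma L2vnormB (R : realType) (Omega : set (R * R))
    (v w : (R * R -> R) * (R * R -> R)) :
  vL2 Omega v -> vL2 Omega w ->
  L2vnorm Omega (v - w) ^+ 2 =
  L2vnorm Omega v ^+ 2 - 2 * L2vip Omega v w + L2vnorm Omega w ^+ 2.
Proof.
move=> [Lv1 Lv2] [Lw1 Lw2].
rewrite !L2vnorm_sqr vfun_subE/= !L2norm_comb// /L2vip.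
by rewrite (L2ipC _ _ v.1) (L2ipC _ _ v.2); ring.
Qed.

Lemma L2vip_scaleB (R : realType) (Omega : set (R * R)) (a : R)
    (v w : (R * R -> R) * (R * R -> R)) :
  vL2 Omega v -> vL2 Omega w ->
  L2vip Omega (a *: (v - w)) v =
  a * (L2vnorm Omega v ^+ 2 - L2vip Omega v w).
Proof.
move=> [Lv1 Lv2] [Lw1 Lw2].
have scaled (f g : R * R -> R) : L2 Omega f -> L2 Omega g ->
    L2ip Omega (a *: ((-1) *: g + f)) f = a * (L2ip Omega f f - L2ip Omega f g).
  move=> Lf Lg; have Lgf := L2_comb _ _ (-1) _ _ Lg Lf.
  rewrite -[a *: _]addr0 L2ip_comb//; last exact: L2_0.
  have -> : L2ip Omega 0 f = 0.
    by have := L2ip_comb _ _ (-1) _ _ _ Lf Lf Lf; rewrite scaleN1r addNr => ->; ring.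
  by rewrite L2ip_comb// (L2ipC _ _ g f); ring.
rewrite vfun_subE L2vnorm_sqr !L2norm_sqr /L2vip /= !scaled//; ring.
Qed.

(** * Weak derivatives and the lagged grad-div form *)

(** Both branches of the total operator land in L^2: a weak derivative is in
    L^2 by definition, and the default value is zero. *)
Lemma weak_derive_L2 (R : realType) (Omega : set (R * R)) (e : R * R)
    (f : R * R -> R) :
  L2 Omega (weak_derive Omega e f).
Proof. by rewrite /weak_derive; case: xgetP => [g _ [//]|_]; exact: L2_0. Qed.

(** The mixed products in the expansions of |a + b'|^2 and |b + a'|^2, for the
    diagonal derivatives [a], [b] at the new level and [a'], [b'] at the old one,
    are twice the lagged coupling terms.  The squares that come along are
    |a|^2 + |b|^2, half of what the unlagged terms provide, and |a'|^2 + |b'|^2,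
    which is the same energy at the old level. *)
Lemma gd_lag_energy (R : realType) (Omega : set (R * R))
    (u : nat -> (R * R -> R) * (R * R -> R)) (n : nat) :
  2 * gd_lag Omega u n.+1 (u n.+1) =
  L2norm Omega (d1 Omega (u n.+1).1 + d2 Omega (u n).2) ^+ 2
  + L2norm Omega (d2 Omega (u n.+1).2 + d1 Omega (u n).1) ^+ 2
  + (L2norm Omega (d1 Omega (u n.+1).1) ^+ 2
     + L2norm Omega (d2 Omega (u n.+1).2) ^+ 2)
  - (L2norm Omega (d1 Omega (u n).1) ^+ 2
     + L2norm Omega (d2 Omega (u n).2) ^+ 2).
Proof.
have d1L2 g : L2 Omega (d1 Omega g) by exact: weak_derive_L2.
have d2L2 g : L2 Omega (d2 Omega g) by exact: weak_derive_L2.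
rewrite /gd_lag [n.+1.-1]/=.
(* From here on the derivatives are arbitrary L^2 functions. *)
have := d1L2 (u n.+1).1; have := d2L2 (u n.+1).2.
have := d1L2 (u n).1; have := d2L2 (u n).2.
move: (d1 _ (u n.+1).1) (d2 _ (u n.+1).2) (d1 _ (u n).1) (d2 _ (u n).2).
move=> a b a' b' Lb' La' Lb La.
rewrite (L2normD _ _ a)// (L2normD _ _ b)// !L2norm_sqr.
by rewrite (L2ipC _ _ b' a) (L2ipC _ _ a' b); ring.
Qed.

(** * The dual norm *)

(** The supremum defining the dual norm skips the [v] of zero gradient norm;
    there the functional vanishes because it is bounded. *)
Lemma Hm1norm_ge (R : realType) (Omega : set (R * R))
    (L : (R * R -> R) * (R * R -> R) -> R) (v : (R * R -> R) * (R * R -> R)) :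
  Hm1 Omega L -> X Omega v -> L v <= Hm1norm Omega L * grad_norm Omega v.
Proof.
move=> [_ [C LC]] Xv.
have [g0|g0] := eqVneq (grad_norm Omega v) 0.
  by rewrite g0 mulr0 (le_trans (ler_norm _))// (le_trans (LC _ Xv))// g0 mulr0.
have g_gt0 : 0 < grad_norm Omega v by rewrite lt_def g0 sqrtr_ge0.
rewrite -ler_pdivrMr// (@le_trans _ _ (`|L v| / grad_norm Omega v))//.
  by rewrite ler_pM2r ?invr_gt0// ler_norm.
apply: ub_le_sup; last by exists v.
exists C => _ [w [Xw w0 ->]].
have w_gt0 : 0 < grad_norm Omega w by rewrite lt_def w0 sqrtr_ge0.
by rewrite (ler_pdivrMr _ _ w_gt0); exact: LC.
Qed.

Lemma young_scaled (R : realFieldType) (nu x y : R) :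
  0 < nu -> 2 * (x * y) <= x ^+ 2 / nu + nu * y ^+ 2.
Proof.
move=> nu_gt0; have nu_neq0 : nu != 0 by rewrite gt_eqF.
rewrite -subr_ge0 (_ : _ - _ = nu^-1 * (x - nu * y) ^+ 2); last by field.
by apply: mulr_ge0; [rewrite invr_ge0 ltW | exact: sqr_ge0].
Qed.

(** * Energy balances *)

(** Of the viscous contribution 2 nu dt |grad uhat|^2, one half is spent on
    the load by Young's inequality with weight nu; this fixes the factor
    dt / nu. *)
Lemma step1_energy (R : realType) (Omega : set (R * R))
    (Xh : set ((R * R -> R) * (R * R -> R))) (Qh : set (R * R -> R))
    (nu dt : R) (L : (R * R -> R) * (R * R -> R) -> R)
    (u uhat : nat -> (R * R -> R) * (R * R -> R)) (p : nat -> R * R -> R)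
    (n : nat) :
  Xh `<=` X Omega -> Xh (u n) -> 0 < nu -> 0 < dt -> Hm1 Omega L ->
  step1 Omega Xh Qh nu dt L u uhat p n ->
  L2vnorm Omega (uhat n.+1) ^+ 2 + L2vnorm Omega (uhat n.+1 - u n) ^+ 2
    + nu * dt * grad_norm Omega (uhat n.+1) ^+ 2
  <= L2vnorm Omega (u n) ^+ 2 + dt / nu * Hm1norm Omega L ^+ 2.
Proof.
move=> XhX Xu nu_gt0 dt_gt0 HL [Xuh Qp momentum incompressible].
have vL2u := X_vL2 _ _ _ (XhX _ Xu).
have Xuhat := XhX _ Xuh; have vL2uh := X_vL2 _ _ _ Xuhat.
have := momentum _ Xuh.
(* Skew-symmetry makes the two halves of the trilinear form equal. *)
rewrite /trilinear_form subrr addr0 L2ipC incompressible// subr0.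
rewrite L2vip_scaleB// -grad_norm_sqr => tested.
have := ler_wpM2l (ltW dt_gt0) (young_scaled _ _ (Hm1norm Omega L)
  (grad_norm Omega (uhat n.+1)) nu_gt0).
have := ler_wpM2l (ltW dt_gt0) (Hm1norm_ge _ _ _ _ HL Xuhat).
rewrite -tested mulrDr mulVKf ?gt_eqF// L2vnormB//.
lra.
Qed.

Lemma step2_energy (R : realType) (Omega : set (R * R))
    (Xh : set ((R * R -> R) * (R * R -> R))) (gamma dt : R)
    (u uhat : nat -> (R * R -> R) * (R * R -> R)) (n : nat) :
  Xh `<=` X Omega -> Xh (uhat n.+1) -> step2 Omega Xh gamma dt u uhat n ->
  L2vnorm Omega (u n.+1) ^+ 2 + L2vnorm Omega (uhat n.+1 - u n.+1) ^+ 2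
    + gamma * dt * (2 * gd_lag Omega u n.+1 (u n.+1))
  = L2vnorm Omega (uhat n.+1) ^+ 2.
Proof.
move=> XhX Xuh [Xu projection].
have vL2u := X_vL2 _ _ _ (XhX _ Xu); have vL2uh := X_vL2 _ _ _ (XhX _ Xuh).
rewrite L2vnormB// -(projection _ Xu).
have -> : L2vip Omega (u n.+1) (u n.+1) = L2vnorm Omega (u n.+1) ^+ 2.
  by rewrite L2vnorm_sqr !L2norm_sqr.
by ring.
Qed.

(** The energy of the intermediate velocity is given exactly by
    [step2_energy], and substituting it into [step1_energy] leaves only the energies of
    the two time levels and dissipation. *)
Lemma energy_step (R : realType) (Omega : set (R * R))
    (Xh : set ((R * R -> R) * (R * R -> R))) (Qh : set (R * R -> R))
    (nu gamma dt : R) (L : (R * R -> R) * (R * R -> R) -> R)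
    (u uhat : nat -> (R * R -> R) * (R * R -> R)) (p : nat -> R * R -> R)
    (n : nat) :
  Xh `<=` X Omega -> Xh (u n) -> 0 < nu -> 0 < dt -> Hm1 Omega L ->
  step1 Omega Xh Qh nu dt L u uhat p n ->
  step2 Omega Xh gamma dt u uhat n ->
  (L2vnorm Omega (u n.+1) ^+ 2
   + gamma * dt * (L2norm Omega (d1 Omega (u n.+1).1) ^+ 2
                   + L2norm Omega (d2 Omega (u n.+1).2) ^+ 2))
  + ((L2vnorm Omega (uhat n.+1 - u n.+1) ^+ 2
      + L2vnorm Omega (uhat n.+1 - u n) ^+ 2)
     + gamma * dt *
         (L2norm Omega (d1 Omega (u n.+1).1 + d2 Omega (u n).2) ^+ 2
          + L2norm Omega (d2 Omega (u n.+1).2 + d1 Omega (u n).1) ^+ 2)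
     + nu * dt * grad_norm Omega (uhat n.+1) ^+ 2)
  <= (L2vnorm Omega (u n) ^+ 2
      + gamma * dt * (L2norm Omega (d1 Omega (u n).1) ^+ 2
                      + L2norm Omega (d2 Omega (u n).2) ^+ 2))
     + dt / nu * Hm1norm Omega L ^+ 2.
Proof.
move=> XhX Xu nu_gt0 dt_gt0 HL s1 s2; have [Xuh _ _ _] := s1.
have := step1_energy _ _ _ _ _ _ _ _ _ _ _ XhX Xu nu_gt0 dt_gt0 HL s1.
rewrite -(step2_energy _ _ _ _ _ _ _ _ XhX Xuh s2) gd_lag_energy.
have combine (k' k s' s q q' r g F c : R) :
    k' + s' + c * (r + q' - q) + s + g <= k + F ->
    (k' + c * q') + ((s' + s) + c * r + g) <= (k + c * q) + F by lra.
exact: combine.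
Qed.

(** * Summation over the time levels *)

Lemma telescope_le (R : numDomainType) (E D F : nat -> R) (N : nat) :
  (forall n, (n < N)%N -> E n.+1 + D n <= E n + F n) ->
  E N + \sum_(0 <= n < N) D n <= E 0%N + \sum_(0 <= n < N) F n.
Proof.
move=> step.
have [tD tF] : \sum_(0 <= n < N) (E n.+1 - E n) = E N - E 0%N /\
    \sum_(0 <= n < N) (E n.+1 - E n) <= \sum_(0 <= n < N) (F n - D n).
  split; first exact: telescope_sumr.
  by apply: ler_sum_nat => n /= nN; rewrite lerBrDr addrAC lerBlDl step.
by move: tF; rewrite tD sumrB lerBlDl addrA lerBrDr.
Qed.

Lemma telescope_weighted_le (R : numDomainType) (E S Q G F : nat -> R)
    (c e k : R) (N : nat) :
  (forall n, (n < N)%N ->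
     E n.+1 + (S n + c * Q n + e * G n) <= E n + k * F n) ->
  E N + \sum_(0 <= n < N) S n + c * \sum_(0 <= n < N) Q n
    + e * \sum_(0 <= n < N) G n
  <= E 0%N + k * \sum_(0 <= n < N) F n.
Proof.
move=> /telescope_le; rewrite !big_split/= -!mulr_sumr.
by rewrite !addrA.
Qed.

Theorem theorem4p3 (R : realType) (Omega : set (R * R))
  (Omega_polygon : convex_polygonal Omega)
  (* the family of meshes and of finite element spaces, indexed by the mesh sizes *)
  (H : set R) (H_gt0 : forall h, H h -> 0 < h)
  (Th : R -> seq (3.-tuple (R * R)))
  (Th_mesh : forall h, H h -> triangulation Omega (Th h) /\ mesh_size (Th h) h)
  (rho : R) (Th_quasi_uniform : quasi_uniform H Th rho)
  (kX kQ : nat)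
  (Xh : R -> set ((R * R -> R) * (R * R -> R))) (Qh : R -> set (R * R -> R))
  (Xh_fe : forall h, H h -> fe_velocity_space Omega (Th h) kX (Xh h))
  (Qh_fe : forall h, H h -> fe_pressure_space Omega (Th h) kQ (Qh h))
  (alpha : R) (alpha_gt0 : 0 < alpha)
  (Xh_Qh_inf_sup : forall h, H h -> inf_sup Omega alpha (Xh h) (Qh h))
  (h : R) (Hh : H h)
  (nu gamma dt : R) (nu_gt0 : 0 < nu) (gamma_ge0 : 0 <= gamma) (dt_gt0 : 0 < dt)
  (N : nat)
  (f : R -> (R * R -> R) * (R * R -> R) -> R)
  (f_L2 : L2_Hm1 Omega (N%:R * dt) f)
  (f_Hm1 : forall n : nat, (n < N)%N -> Hm1 Omega (f (n.+1%:R * dt)))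
  (u uhat : nat -> (R * R -> R) * (R * R -> R)) (p : nat -> R * R -> R)
  (u0 : Xh h (u 0%N))
  (u_step1 : forall n : nat, (n < N)%N ->
    step1 Omega (Xh h) (Qh h) nu dt (f (n.+1%:R * dt)) u uhat p n)
  (u_step2 : forall n : nat, (n < N)%N ->
    step2 Omega (Xh h) gamma dt u uhat n) :
  L2vnorm Omega (u N) ^+ 2
  + gamma * dt * (L2norm Omega (d1 Omega (u N).1) ^+ 2
                  + L2norm Omega (d2 Omega (u N).2) ^+ 2)
  + \sum_(0 <= n < N) (L2vnorm Omega (uhat n.+1 - u n.+1) ^+ 2
                       + L2vnorm Omega (uhat n.+1 - u n) ^+ 2)
  + gamma * dt * \sum_(0 <= n < N)
      (L2norm Omega (d1 Omega (u n.+1).1 + d2 Omega (u n).2) ^+ 2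
       + L2norm Omega (d2 Omega (u n.+1).2 + d1 Omega (u n).1) ^+ 2)
  + nu * dt * \sum_(0 <= n < N) grad_norm Omega (uhat n.+1) ^+ 2
  <= L2vnorm Omega (u 0%N) ^+ 2
     + gamma * dt * (L2norm Omega (d1 Omega (u 0%N).1) ^+ 2
                     + L2norm Omega (d2 Omega (u 0%N).2) ^+ 2)
     + dt / nu * \sum_(0 <= n < N) Hm1norm Omega (f (n.+1%:R * dt)) ^+ 2.
Proof.
have [_ XhX _] := Xh_fe _ Hh.
have Xu n : (n <= N)%N -> Xh h (u n) by case: n => // n /u_step2[].
pose E n := L2vnorm Omega (u n) ^+ 2
  + gamma * dt * (L2norm Omega (d1 Omega (u n).1) ^+ 2
                  + L2norm Omega (d2 Omega (u n).2) ^+ 2).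
pose S n := L2vnorm Omega (uhat n.+1 - u n.+1) ^+ 2
  + L2vnorm Omega (uhat n.+1 - u n) ^+ 2.
pose Q n := L2norm Omega (d1 Omega (u n.+1).1 + d2 Omega (u n).2) ^+ 2
  + L2norm Omega (d2 Omega (u n.+1).2 + d1 Omega (u n).1) ^+ 2.
pose G n := grad_norm Omega (uhat n.+1) ^+ 2.
pose F n := Hm1norm Omega (f (n.+1%:R * dt)) ^+ 2.
have step n : (n < N)%N ->
    E n.+1 + (S n + gamma * dt * Q n + nu * dt * G n) <= E n + dt / nu * F n.
  move=> nN; exact: (energy_step _ _ _ _ _ _ _ _ _ _ _ _ XhX (Xu _ (ltnW nN))
    nu_gt0 dt_gt0 (f_Hm1 _ nN) (u_step1 _ nN) (u_step2 _ nN)).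
exact: (telescope_weighted_le _ E S Q G F _ _ _ N step).
Qed.
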